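(* Let $G=(V,E)$ be a finite connected directed graph and let $c\in\mathbb{R}^{|E|}$. Then the combinatorial diameter of the dual network flow polyhedron $P_{G,c}$ satisfies $$\operatorname{diam}(P_{G,c})\;\le\;\min\Big\{(|V|-1)\cdot|E|,\ \frac{|V|^3}{6}\Big\}.$$
   Context: Directed graphs are finite, without loops and without parallel arcs: $E$ is a set of ordered pairs $ab$ of distinct nodes $a,b\in V$ (arc from tail $a$ to head $b$); both $ab$ and $ba$ may be present. ''Connected'' means that the underlying undirected graph is connected. One node of $V$ is designated as node $0$. For $c\in\mathbb{R}^{|E|}$ (with arbitrary real entries $c_{ab}$, $ab\in E$), the dual network flow polyhedron is $$P_{G,c}=\{u\in\mathbb{R}^{|V|}: -u_a+u_b\le c_{ab}\ \text{ for all } ab\in E,\ u_0=0\}.$$ For vertices $v^{(1)},v^{(2)}$ of a polyhedron $P$, an edge walk of length $k$ from $v^{(1)}$ to $v^{(2)}$ is a sequence of vertices $v^{(1)}=y^{(0)},\dots,y^{(k)}=v^{(2)}$ of $P$ such that every two consecutive vertices are connected by an edge (1-dimensional face) of $P$. The combinatorial distance of $v^{(1)}$ and $v^{(2)}$ is the minimum length of an edge walk between them, and the combinatorial diameter $\operatorname{diam}(P)$ is the maximum combinatorial distance between any two vertices of $P$. (If $P_{G,c}$ is empty there are no vertices and the statement is vacuous.) *)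

(* Defs.v *)
From mathcomp Require Import all_boot all_order all_algebra.
From mathcomp Require Import classical_sets reals constructive_ereal ereal.

Set Implicit Arguments.
Unset Strict Implicit.
Unset Printing Implicit Defensive.

Import Order.TTheory GRing.Theory Num.Theory.
Local Open Scope classical_set_scope.
Local Open Scope ring_scope.

Section Faces.
Variables (R : realType) (U : vectType R).
Implicit Types (P F S : set U) (v w : U).

Definition is_face P F := exists (f : 'Hom(U, R^o)) (b : R),
  (forall x, P x -> (f x : R) <= b) /\ F = [set x | P x /\ (f x : R) = b].

(* The subspace D below is the direction of the affine hull of S; the empty
   set has no dimension in this sense. *)
Definition has_dim S (k : nat) := exists x (D : {vspace U}),
  [/\ S x,
      forall y, S y -> y - x \in D,
      forall D' : {vspace U}, (forall y, S y -> y - x \in D') -> (D <= D')%VS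
    & \dim D = k].

Definition is_vertex P v := is_face P [set v].

Definition is_edge P F := is_face P F /\ has_dim F 1.

(* A 1-dimensional face of a polyhedron contains at most two vertices, so two
   distinct vertices lying on an edge are its endpoints. *)
Definition adjacent P v w :=
  v <> w /\ exists F, [/\ is_edge P F, F v & F w].

Definition edge_walk P (k : nat) v w := exists y : nat -> U,
  [/\ y 0 = v, y k = w,
      forall i, (i <= k)%N -> is_vertex P (y i)
    & forall i, (i < k)%N -> adjacent P (y i) (y i.+1)].

(* +oo when there is no edge walk from v to w *)
Definition comb_dist P v w : \bar R :=
  ereal_inf [set (k%:R)%:E | k in [set k : nat | edge_walk P k v w]].

(* -oo when P has no vertex *)
Definition comb_diam P : \bar R :=
  ereal_sup [set d | exists v w,
    [/\ is_vertex P v, is_vertex P w & d = comb_dist P v w]].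

End Faces.

Section Digraphs.
Variable V : finType.

Definition loopless (E : {set V * V}) := forall a b, (a, b) \in E -> a <> b.

Definition weakly_connected (E : {set V * V}) := forall a b : V,
  connect (fun x y => ((x, y) \in E) || ((y, x) \in E)) a b.

(* Only the values of c on the arcs of E matter. *)
Definition dual_flow_polyhedron (R : realType) (r : V) (E : {set V * V})
    (c : V -> V -> R) : set {ffun V -> R^o} :=
  [set u | (forall a b, (a, b) \in E -> - (u a : R) + (u b : R) <= c a b)
           /\ (u r : R) = 0].

End Digraphs.

(* Main.v *)
(** To walk from a vertex [u] to a vertex [v], make arcs tight at [v] tight one
after the other and contract them. With [k] classes of contracted nodes left,
take an arc [ab] tight at [v] between two classes. Let [S] be the set of nodes
reachable from [a] by tight arcs and contracted arcs. If [b] lies in [S], then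
[u b - u a] is maximal over the polyhedron restricted to the contracted arcs, so
[ab] is tight. Otherwise raise the component [K] of [b] in the tight graph outside
[S] until an arc entering [K] becomes tight; both sides of the cut are connected
by tight arcs, so this follows an edge. The arcs lost go from [K] to [S]. As [S]
only grows and never moves, while other nodes only rise, an arc lost is never
tight again, and neither is it lost in the other direction. So a phase takes at
most as many steps as there are arcs, and at most [k(k-1)/2] steps, one per
unordered pair of classes. Summing over [k = 2, ..., n] gives [(n-1)|E|] and
[(n^3-n)/6]. *)

Require Import Defs.
From HB Require Import structures.
From mathcomp Require Import all_boot all_order all_algebra.
From mathcomp Require Import zify ring lra.
From mathcomp Require Import classical_sets reals constructive_ereal ereal.

Set Implicit Arguments.
Unset Strict Implicit.
Unset Printing Implicit Defensive.

Import Order.TTheory GRing.Theory Num.Theory.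
Local Open Scope ring_scope.

Lemma connect_ind (T : finType) (e : rel T) (Q : T -> Prop) (x y : T) :
  Q x -> (forall y z, Q y -> e y z -> Q z) -> connect e x y -> Q y.
Proof.
move=> Qx Qe /connectP[p pe ->] {y}.
by elim: p x Qx pe => //= z p IHp x Qx /andP[xz]; apply: IHp; apply: Qe xz.
Qed.

Arguments connect_ind {T e} Q {x y}.

Section Walks.
Variables (R : realType) (U : vectType R) (P : set U).

Lemma edge_walk0 v : is_vertex P v -> edge_walk P 0 v v.
Proof. by exists (fun=> v). Qed.

Lemma edge_walk_cons k v w z : is_vertex P v -> adjacent P v w ->
  edge_walk P k w z -> edge_walk P k.+1 v z.
Proof.
move=> vP vw [y [y0 yk yP yadj]].
exists (fun i => if i is j.+1 then y j else v); split=> // [[|i]|[|i]] //.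
- by move=> ik; apply: yP.
- by rewrite y0.
- by move=> ik; apply: yadj.
Qed.

Lemma edge_walk_cat k l v w z :
  edge_walk P k v w -> edge_walk P l w z -> edge_walk P (k + l) v z.
Proof.
elim: k v => [|k IHk] v [y [y0 yk yP yadj]] wz; first by rewrite -y0 yk.
rewrite addSn -y0; apply: (@edge_walk_cons _ _ (y 1%N)); [exact: yP|exact: yadj|].
by apply: IHk wz; exists (fun i => y i.+1); split=> // i ik; [apply: yP|apply: yadj].
Qed.

End Walks.

Section DualFlow.
Variables (R : realType) (V : finType) (r : V) (E : {set V * V}) (c : V -> V -> R).
Local Notation U := {ffun V -> R^o}.
Local Notation P := (dual_flow_polyhedron r E c).
Implicit Types (u v w : U) (K : {set V}) (A : {set V * V}) (rho : V -> V).

Definition slack u x y : R := c x y - ((u y : R) - (u x : R)).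

Definition tight u : rel V := [rel x y | ((x, y) \in E) && (slack u x y == 0)].

Definition utight u : rel V := [rel x y | tight u x y || tight u y x].

Definition spanning u := forall x y, connect (utight u) x y.

Lemma utight_sym u : symmetric (utight u).
Proof. by move=> x y; rewrite /utight /= orbC. Qed.

Lemma polyP u : P u <-> (forall x y, (x, y) \in E -> 0 <= slack u x y) /\ (u r : R) = 0.
Proof.
rewrite /dual_flow_polyhedron /= /slack; split=> -[uE ur]; split=> // x y /uE; lra.
Qed.

Definition coord x u : R^o := u x.

Lemma coord_is_linear x : linear (coord x).
Proof. by move=> k u w; rewrite /coord !ffunE. Qed.
HB.instance Definition _ x :=
  GRing.isLinear.Build R U R^o _ (coord x) (coord_is_linear x).

Definition arc_form A : 'Hom(U, R^o) :=
  \sum_(e in A) (linfun (coord e.2) - linfun (coord e.1)).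

Lemma arc_formE A u : (arc_form A u : R) = \sum_(e in A) ((u e.2 : R) - (u e.1 : R)).
Proof.
rewrite /arc_form sum_lfunE; apply: eq_bigr => e _.
by rewrite add_lfunE opp_lfunE !lfunE.
Qed.

Lemma tight_face A : A \subset E ->
  is_face P [set u | P u /\ forall x y, (x, y) \in A -> slack u x y = 0].
Proof.
move=> AE; exists (arc_form A), (\sum_(e in A) c e.1 e.2).
have slackE u : \sum_(e in A) c e.1 e.2 - (arc_form A u : R) = \sum_(e in A) slack u e.1 e.2.
  by rewrite arc_formE -sumrB.
have slack_ge0 u : P u -> forall e, e \in A -> 0 <= slack u e.1 e.2.
  by move=> /polyP[uE _] [x y] /(fintype.subsetP AE); apply: uE.
split=> [u Pu|].
  by rewrite -subr_ge0 slackE; apply: sumr_ge0 => e; apply: slack_ge0.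
apply/seteqP; split=> u /= [Pu uA]; split=> //.
  by apply/esym/eqP; rewrite -subr_eq0 slackE big1// => -[x y] /uA.
move=> x y xyA; have /eqP := slackE u; rewrite uA subrr eq_sym psumr_eq0; last first.
  by move=> e; apply: slack_ge0.
by move=> /allP/(_ (x, y)); rewrite mem_index_enum xyA /= => /(_ isT)/eqP.
Qed.

Lemma vertex_poly u : is_vertex P u -> P u.
Proof.
by case=> f [m [_ /seteqP[/(_ u erefl)[]]]].
Qed.

Lemma spanning_vertex u : P u -> spanning u -> is_vertex P u.
Proof.
move=> Pu uT; pose A := [set e in E | tight u e.1 e.2].
have AE : A \subset E by apply/fintype.subsetP => e; rewrite inE => /andP[].
suff -> : is_vertex P u =
    is_face P [set w | P w /\ forall x y, (x, y) \in A -> slack w x y = 0].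
  exact: tight_face.
congr (is_face P _); apply/seteqP; split=> w /=.
  move=> ->; split=> // x y; rewrite inE /= => /andP[_ /andP[_ /eqP//]].
move=> [Pw wA].
have ctr x y : tight u x y -> (w y : R) - (w x : R) = (u y : R) - (u x : R).
  move=> uxy; have /wA : (x, y) \in A.
    by move: (uxy); rewrite inE /= /tight /= => /andP[->].
  by case/andP: uxy => _ /eqP; rewrite /slack; lra.
apply/ffunP => x.
have [_ ur] := (polyP u).1 Pu; have [_ wr] := (polyP w).1 Pw.
suff : (w x : R) - (u x : R) = 0 by move/eqP; rewrite subr_eq0 => /eqP.
apply: (connect_ind (fun x => (w x : R) - (u x : R) = 0) _ _ (uT r x)).
  by rewrite ur wr subrr.
by move=> y z yE /orP[] /ctr; lra.
Qed.

Definition shift u K (t : R) : U :=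
  [ffun x => (u x : R) + t * ((x \in K)%:R - (r \in K)%:R)].

Lemma slack_shift u K t x y :
  slack (shift u K t) x y = slack u x y - t * ((y \in K)%:R - (x \in K)%:R).
Proof. by rewrite /slack /shift !ffunE; ring. Qed.

Lemma shift_root u K t : (u r : R) = 0 -> (shift u K t r : R) = 0.
Proof. by move=> ur; rewrite ffunE ur; ring. Qed.

Lemma vertex_spanning u : is_vertex P u -> spanning u.
Proof.
move=> uV; suff uT x : connect (utight u) r x.
  have sym : connect_sym (utight u) by exact: sym_connect_sym (utight_sym u).
  by move=> x y; apply: (connect_trans _ (uT y)); rewrite sym.
apply/idPn => rx; have Pu := vertex_poly uV.
have [slack_ge0 ur] := (polyP u).1 Pu.
pose K := [set y | connect (utight u) x y].
have rK : r \notin K.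
  apply: contra rx; rewrite inE.
  by rewrite (sym_connect_sym (utight_sym u)).
have xK : x \in K by rewrite inE connect0.
have crossing y z : (y, z) \in E -> (y \in K) != (z \in K) -> 0 < slack u y z.
  move=> yzE yzK; rewrite ltNge; apply: contra yzK => slack_le0.
  have yz : tight u y z by rewrite /tight /= yzE eq_le slack_le0 slack_ge0.
  apply/eqP; rewrite !inE; apply/idP/idP => xy; apply: (connect_trans xy); apply: connect1.
    by rewrite /utight /= yz.
  by rewrite /utight /= yz orbT.
pose B := [set e in E | (e.1 \in K) != (e.2 \in K)].
pose m := \big[Num.min/1]_(e in B) slack u e.1 e.2.
have m_gt0 : 0 < m.
  rewrite /m; elim/big_ind: _ => // [y z y0 z0|[y z]]; first by rewrite lt_min y0.
  by rewrite inE => /andP[]; apply: crossing.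
have m_le y z : (y, z) \in E -> (y \in K) != (z \in K) -> m <= slack u y z.
  move=> yzE yzK; have yzB : (y, z) \in B by rewrite inE yzE.
  exact: (bigmin_le_cond 1 (fun e => slack u e.1 e.2) yzB).
have shiftP t : - m <= t <= m -> P (shift u K t).
  move=> /andP[t1 t2]; apply/polyP; split; last exact: shift_root.
  move=> y z yzE; rewrite slack_shift; move: (slack_ge0 _ _ yzE) (m_le _ _ yzE).
  by case: (y \in K); case: (z \in K) => /= s0 sm; [|have := sm isT|have := sm isT|]; lra.
case: uV => f [b [fb /seteqP[uf fu]]].
have [_ fub] : P u /\ (f u : R) = b by apply: uf.
pose d : U := shift 0 K 1.
have shiftE t : shift u K t = u + t *: d.
  by apply/ffunP => y; rewrite !ffunE /= add0r mul1r.
have fshift t : (f (shift u K t) : R) = b + t * (f d : R).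
  by rewrite shiftE linearD linearZ /= fub.
have fm : (f (shift u K m) : R) <= b by apply/fb/shiftP; lra.
have fNm : (f (shift u K (- m)) : R) <= b by apply/fb/shiftP; lra.
have mfd : m * (f d : R) = 0.
  by rewrite !fshift in fm fNm; lra.
have /ffunP/(_ x) : shift u K m = u.
  by apply: fu; split; [apply: shiftP; lra|rewrite fshift mfd addr0].
by rewrite ffunE xK (negPf rK) subr0 mulr1 => /eqP; rewrite -subr_eq0 addrAC subrr add0r gt_eqF.
Qed.

Lemma shift_adjacent u K t b a : P u -> P (shift u K t) -> 0 < t ->
    b \in K -> a \notin K ->
    (forall x y, (x \in K) = (y \in K) ->
       connect [rel x y | ((x \in K) == (y \in K)) && utight u x y] x y) ->
  adjacent P u (shift u K t).
Proof.
move=> Pu Pw t_gt0 bK aK uT; set w := shift u K t in Pw *.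
have [_ ur] := (polyP u).1 Pu; have [_ wr] := (polyP w).1 Pw.
have uw : w != u.
  apply/eqP => wu.
  have : ((w b : R) - (w a : R)) - ((u b : R) - (u a : R)) = t.
    by rewrite /w /shift !ffunE bK (negPf aK) /=; ring.
  by rewrite wu subrr => t0; move: t_gt0; rewrite -t0 ltxx.
split; first by move/eqP; rewrite eq_sym (negPf uw).
pose A := [set e in E | ((e.1 \in K) == (e.2 \in K)) && tight u e.1 e.2].
have AE : A \subset E by apply/fintype.subsetP => e; rewrite inE => /andP[].
pose F : set U := [set z | P z /\ forall x y, (x, y) \in A -> slack z x y = 0]%classic.
have Fu : F u.
  by split=> // x y; rewrite inE => /and3P[_ _ /andP[_ /eqP]].
have Fw : F w.
  split=> // x y; rewrite inE => /and3P[_ /eqP /= xyK /andP[_ /eqP uxy]].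
  by rewrite slack_shift uxy xyK subrr mulr0 subrr.
exists F; split=> //; split; first exact: tight_face.
exists u, <[w - u]>%VS; split=> //.
- move=> z [Pz zA]; have [_ zr] := (polyP z).1 Pz.
  have cst x y : (x \in K) = (y \in K) -> (z y : R) - (u y : R) = (z x : R) - (u x : R).
    move=> xyK; pose Q y := (z y : R) - (u y : R) = (z x : R) - (u x : R).
    apply: (connect_ind Q _ _ (uT _ _ xyK)) => //; rewrite /Q.
    move=> p q <- /andP[pqK] /orP[] pq.
      have /zA : (p, q) \in A by rewrite inE pqK pq; case/andP: pq => ->.
      by case/andP: pq => _ /eqP; rewrite /slack; lra.
    have /zA : (q, p) \in A by rewrite inE eq_sym pqK pq; case/andP: pq => ->.
    by case/andP: pq => _ /eqP; rewrite /slack; lra.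
  apply/vlineP; exists ((((z b : R) - (u b : R)) - ((z a : R) - (u a : R))) / t).
  apply/ffunP => x; rewrite !ffunE /=.
  set k := _ / t.
  have kt : k * t = (((z b : R) - (u b : R)) - ((z a : R) - (u a : R))).
    by rewrite /k divfK// gt_eqF.
  suff h : (z x : R) - (u x : R) = k * t * ((x \in K)%:R - (r \in K)%:R).
    rewrite [LHS]h -mulrA; congr (_ * _).
    by rewrite addrAC subrr add0r.
  have value y : (z y : R) - (u y : R) =
      (z a : R) - (u a : R) + k * t * (y \in K)%:R.
    rewrite kt; case yK: (y \in K).
      by rewrite (cst b y) ?bK ?yK //=; ring.
    by rewrite (cst a y) ?yK ?(negPf aK) //=; ring.
  have := value r; rewrite zr ur subrr => e0.
  rewrite value mulrBr; lra.
- by move=> D' FD'; rewrite -memvE; apply: FD'.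
- by rewrite dim_vline subr_eq0 uw.
Qed.

Definition reach u rho a : {set V} :=
  [set x | connect [rel x y | tight u x y || (rho x == rho y)] a x].

Definition intra u rho : rel V := [rel x y | (rho x == rho y) && utight u x y].

(* [rho] names the class of each node: classes are contracted sets of nodes, whose
   relative position is already that of the target [v]. *)
Record on_track v rho u : Prop := OnTrack {
  track_vertex : is_vertex P u;
  track_agree : forall x y, rho x = rho y ->
    (u y : R) - (u x : R) = (v y : R) - (v x : R);
  track_intra : forall x y, rho x = rho y -> connect (intra u rho) x y }.

(* No arc from the class of [y] to that of [x] can be lost in the rest of the
   phase, nor one in the opposite direction, since [x] stays in [reach]. *)
Definition dead u rho a y x :=
  (x \in reach u rho a) &&
  [forall p, forall q, (rho p == rho y) && (rho q == rho x) ==> ~~ tight u p q].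

Definition live_arcs u rho a : {set V * V} :=
  [set e in E | [&& rho e.1 != rho e.2, ~~ dead u rho a e.1 e.2 & ~~ dead u rho a e.2 e.1]].

Definition live_pairs u rho a : {set {set V}} :=
  [set [set rho e.1; rho e.2] | e in live_arcs u rho a].

Lemma deadP u rho a y x :
  reflect (x \in reach u rho a /\
           forall p q, rho p = rho y -> rho q = rho x -> ~~ tight u p q)
          (dead u rho a y x).
Proof.
apply: (iffP andP) => -[xS yx]; split=> //.
  by move=> p q /eqP py /eqP qx; move/forallP/(_ p)/forallP/(_ q): yx; rewrite py qx.
by apply/forallP => p; apply/forallP => q; apply/implyP => /andP[/eqP py /eqP qx]; apply: yx.
Qed.

Lemma reach_root u rho a : a \in reach u rho a.
Proof. by rewrite inE connect0. Qed.

Lemma reach_tight u rho a x y : x \in reach u rho a -> tight u x y -> y \in reach u rho a.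
Proof.
by rewrite !inE => ax xy; apply: (connect_trans ax); apply: connect1; rewrite /= xy.
Qed.

Lemma reach_class u rho a x y : rho x = rho y -> (x \in reach u rho a) = (y \in reach u rho a).
Proof.
by move=> xy; rewrite !inE; apply/idP/idP => ax; apply: (connect_trans ax);
  apply: connect1; rewrite /= xy eqxx orbT.
Qed.

Lemma dead_class u rho a y x p q : rho p = rho y -> rho q = rho x ->
  dead u rho a p q = dead u rho a y x.
Proof. by move=> py qx; rewrite /dead (reach_class _ _ qx) py qx. Qed.

Section Pivot.
Variables (u v : U) (rho : V -> V) (a b : V).
Hypotheses (uv : on_track v rho u) (abE : (a, b) \in E).
Local Notation S := (reach u rho a).
Hypothesis bS : b \notin S.

Let K : {set V} :=
  [set x | connect [rel x y | [&& x \notin S, y \notin S & utight u x y]] b x].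

Let Pu : P u := vertex_poly (track_vertex uv).

Let slack_ge0 x y : (x, y) \in E -> 0 <= slack u x y.
Proof. exact: ((polyP u).1 Pu).1. Qed.

Let uT : spanning u := vertex_spanning (track_vertex uv).

Let bK : b \in K.
Proof. by rewrite inE connect0. Qed.

Let KS x : x \in K -> x \notin S.
Proof.
by rewrite inE; apply: (connect_ind (fun x => x \notin S)) => // y z _ /and3P[].
Qed.

Let aK : a \notin K.
Proof. by apply/negP => /KS; rewrite reach_root. Qed.

Let K_utight x y : x \in K -> y \notin S -> utight u x y -> y \in K.
Proof.
move=> xK yS xy; move: (xK); rewrite !inE => bx; apply: (connect_trans bx).
by apply: connect1; rewrite /= yS xy KS.
Qed.

Let K_class x y : rho x = rho y -> (x \in K) = (y \in K).
Proof.
suff imp p q : rho p = rho q -> p \in K -> q \in K by move=> xy; apply/idP/idP; apply: imp.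
move=> pq pK; apply: (connect_ind (fun q => q \in K) _ _ (track_intra uv pq)) => //.
move=> s z sK /andP[/eqP sz]; apply: K_utight => //.
by rewrite -(reach_class _ _ sz) KS.
Qed.

Let no_entering x y : x \notin K -> y \in K -> ~~ tight u x y.
Proof.
move=> xK yK; apply/negP => xy; have [xS|xS] := boolP (x \in S).
  by move: (KS yK); rewrite (reach_tight xS xy).
by move: xK; rewrite (K_utight yK xS)// /utight /= xy orbT.
Qed.

Let leaving : exists x y, [/\ x \in K, y \in S & tight u x y].
Proof.
pose leave := [exists x, exists y, [&& x \in K, y \in S & tight u x y]].
have [/existsP[x /existsP[y /and3P[xK yS xy]]]|none] := boolP leave; first by exists x, y.
suff : a \in K by rewrite (negPf aK).
apply: (connect_ind (fun x => x \in K) _ _ (uT b a)) => // x y xK xy.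
apply: contraR none => yK.
have yS : y \in S by apply: contraR yK => yS; apply: K_utight xy.
apply/existsP; exists x; apply/existsP; exists y; rewrite xK yS /=.
by case/orP: xy => // yx; move: (no_entering yK xK); rewrite yx.
Qed.

Let sides_connected x y : (x \in K) = (y \in K) ->
  connect [rel x y | ((x \in K) == (y \in K)) && utight u x y] x y.
Proof.
set e := [rel x y | _].
have esym : connect_sym e.
  by apply: sym_connect_sym => p q; rewrite /e /= utight_sym eq_sym.
have bKe p : p \in K -> connect e b p.
  move=> pK; suff [] : connect e b p /\ p \in K by [].
  move: (pK); rewrite {1}inE; apply: (connect_ind (fun p => connect e b p /\ p \in K)) => //.
  move=> q z [bq qK] /and3P[_ zS qz]; have zK := K_utight qK zS qz.
  by split=> //; apply: (connect_trans bq); apply: connect1; rewrite /e /= qK zK.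
have aSe p : p \in S -> connect e a p.
  move=> pS; suff [] : connect e a p /\ p \in S by [].
  move: (pS); rewrite {1}inE; apply: (connect_ind (fun p => connect e a p /\ p \in S)).
    by split=> //; apply: reach_root.
  have SK q : q \in S -> q \in K = false by move=> qS; apply/negP => /KS; rewrite qS.
  move=> q z [aq qS] /orP[qz|/eqP qz].
    have zS := reach_tight qS qz.
    by split=> //; apply: (connect_trans aq); apply: connect1; rewrite /e /= !SK// eqxx /utight /= qz.
  split; last by rewrite -(reach_class _ _ qz).
  apply: (connect_trans aq); apply: connect_sub (track_intra uv qz) => s t /andP[/eqP st ut].
  by apply: connect1; rewrite /e /= (K_class st) eqxx.
have aKe p : p \notin K -> connect e a p.
  move=> pK; suff : p \in K \/ connect e a p by case=> //; rewrite (negPf pK).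
  apply: (connect_ind (fun p => p \in K \/ connect e a p) _ _ (uT a p)).
    by right; apply: connect0.
  move=> q z qKe qz; have [zK|zK] := boolP (z \in K); [by left|right].
  have [qK|qK] := boolP (q \in K).
    by apply: aSe; apply: contraR zK => zS; apply: K_utight qz.
  case: qKe => [|aq]; first by rewrite (negPf qK).
  by apply: (connect_trans aq); apply: connect1; rewrite /e /= (negPf qK) (negPf zK).
move=> xyK; have [yK|yK] := boolP (y \in K).
  by apply: (connect_trans _ (bKe _ yK)); rewrite esym bKe// xyK.
by apply: (connect_trans _ (aKe _ yK)); rewrite esym aKe// xyK.
Qed.

Section Shift.
Variables (t : R) (p q : V).
Hypotheses (t_gt0 : 0 < t) (pqE : (p, q) \in E) (pK : p \notin K) (qK : q \in K).
Hypothesis t_slack : t = slack u p q.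
Hypothesis t_min : forall x y, (x, y) \in E -> x \notin K -> y \in K -> t <= slack u x y.

Local Notation w := (shift u K t).

Let Pw : P w.
Proof.
apply/polyP; split; last by apply: shift_root; case/polyP: Pu.
move=> x y xyE; rewrite slack_shift; move: (slack_ge0 xyE) (t_min xyE).
move: t_gt0; case: (x \in K); case: (y \in K) => /= t0 s0 sm; [| |have := sm isT isT|]; lra.
Qed.

Let tight_side x y : (x \in K) = (y \in K) -> tight w x y = tight u x y.
Proof. by move=> xy; rewrite /tight /= slack_shift xy subrr mulr0 subr0. Qed.

Let utight_side x y : (x \in K) = (y \in K) -> utight w x y = utight u x y.
Proof. by move=> xy; rewrite /utight /= !tight_side. Qed.

Let spanning_shift : spanning w.
Proof.
have sym := sym_connect_sym (@utight_sym w).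
have same x y : (x \in K) = (y \in K) -> connect (utight w) x y.
  move=> /sides_connected; apply: connect_sub => s z /andP[/eqP sz uz].
  by apply: connect1; rewrite utight_side.
have pq : connect (utight w) p q.
  apply: connect1; rewrite /utight /= /tight /= pqE slack_shift qK (negPf pK) -t_slack.
  by rewrite subr0 mulr1 subrr eqxx.
have toq x : connect (utight w) x q.
  have [xK|xK] := boolP (x \in K); first by apply: same; rewrite xK qK.
  by apply: connect_trans pq; apply: same; rewrite (negPf xK) (negPf pK).
by move=> x y; apply: (connect_trans (toq x)); rewrite sym.
Qed.

Lemma shift_on_track : on_track v rho w.
Proof.
split; first exact: spanning_vertex.
  move=> x y xy; rewrite -(track_agree uv xy) !ffunE (K_class xy).
  by ring.
move=> x y xy; apply: connect_sub (track_intra uv xy) => s z /andP[/eqP sz uz].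
by apply: connect1; rewrite /intra /= sz eqxx utight_side ?(K_class sz).
Qed.

Let reach_shift x : x \in S -> x \in reach w rho a.
Proof.
move=> xS; suff [] : x \in reach w rho a /\ x \in S by [].
move: (xS); rewrite {1}inE; apply: (connect_ind (fun x => x \in reach w rho a /\ x \in S)).
  by split; apply: reach_root.
move=> y z [yw yS] /orP[yz|/eqP yz]; last by rewrite -!(reach_class _ _ yz).
have zS := reach_tight yS yz; split=> //; apply: reach_tight yw _.
have SK s : s \in S -> s \in K = false by move=> sS; apply/negP => /KS; rewrite sS.
by rewrite tight_side ?SK.
Qed.

(* Nothing in [S] moves, so an arc with head in [S] can only gain slack. *)
Let tight_shift x y : y \in S -> tight w x y -> tight u x y && (x \notin K).
Proof.
move=> yS /andP[xyE]; rewrite slack_shift /tight /= xyE /=.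
have -> : y \in K = false by apply/negP => /KS; rewrite yS.
have := slack_ge0 xyE; have := t_gt0; case: (x \in K) => /= t0 s0 /eqP s.
  by exfalso; move: s; lra.
by rewrite andbT; apply/eqP; lra.
Qed.

Let dead_shift y x : dead u rho a y x -> dead w rho a y x.
Proof.
move=> /deadP[xS dead_yx]; apply/deadP; split=> [|s z sy zx]; first exact: reach_shift.
apply: contra (dead_yx _ _ sy zx) => /tight_shift.
by rewrite (reach_class _ _ zx) => /(_ xS)/andP[].
Qed.

Lemma live_shift : (#|live_pairs w rho a| < #|live_pairs u rho a|)%N.
Proof.
apply: proper_card; apply/properP; split.
  apply: imsetS; apply/fintype.subsetP => e; rewrite !inE => /and4P[-> -> /=].
  by move=> /(contra (@dead_shift _ _)) -> /(contra (@dead_shift _ _)) ->.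
have [y [x [yK xS yx]]] := leaving.
have yS := KS yK.
have yx_rho : rho y != rho x.
  by apply: contra yS => /eqP yx_rho; rewrite (reach_class _ _ yx_rho).
have deadw : dead w rho a y x.
  apply/deadP; split=> [|s z sy zx]; first exact: reach_shift.
  apply/negP => /tight_shift; rewrite (reach_class _ _ zx) => /(_ xS)/andP[_].
  by rewrite (K_class sy) yK.
exists [set rho y; rho x].
  apply: (imset_f (fun e => [set rho e.1; rho e.2]) (x := (y, x))).
  rewrite inE /= yx_rho; case/andP: (yx) => -> _ /=; apply/andP; split; apply/deadP => -[].
    by move=> _ /(_ y x erefl erefl); rewrite yx.
  by rewrite (negPf yS).
apply/imsetP => -[[s z]]; rewrite inE /= => /and4P[_ sz dsz dzs] pairE.
have /setP/(_ (rho y)) := pairE; have /setP/(_ (rho x)) := pairE.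
rewrite !inE !eqxx orbT /= => /esym/orP[] /eqP xE /esym/orP[] /eqP yE.
- by rewrite xE yE eqxx in yx_rho.
- by move: dzs; rewrite (dead_class _ _ (esym yE) (esym xE)) deadw.
- by move: dsz; rewrite (dead_class _ _ (esym yE) (esym xE)) deadw.
- by rewrite xE yE eqxx in yx_rho.
Qed.

Lemma shift_step : adjacent P u w.
Proof. exact: (shift_adjacent Pu Pw t_gt0 bK aK sides_connected). Qed.

End Shift.

Lemma pivot : exists w, [/\ adjacent P u w, on_track v rho w
  & (#|live_pairs w rho a| < #|live_pairs u rho a|)%N].
Proof.
pose B := [pred e : V * V | [&& e \in E, e.1 \notin K & e.2 \in K]].
have Bab : B (a, b) by rewrite /B /= abE aK bK.
case: (arg_minP (fun e => slack u e.1 e.2) Bab) => -[p q] /and3P[/= pqE pK qK] pq_min.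
have t_gt0 : 0 < slack u p q.
  rewrite lt_neqAle slack_ge0// andbT eq_sym.
  by have := no_entering pK qK; rewrite /tight /= pqE.
have t_min x y : (x, y) \in E -> x \notin K -> y \in K -> slack u p q <= slack u x y.
  by move=> xyE xK yK; apply: (pq_min (x, y)); rewrite /= xyE xK.
exists (shift u K (slack u p q)); split.
- exact: shift_step t_gt0 t_min.
- exact: shift_on_track pqE pK qK erefl t_min.
- exact: live_shift.
Qed.

End Pivot.

Lemma reach_tight_target u v rho a b : P u -> P v -> on_track v rho u ->
  tight v a b -> b \in reach u rho a -> tight u a b.
Proof.
move=> /polyP[uE _] /polyP[vE _] uv /andP[abE /eqP vab] bS.
have vu x : x \in reach u rho a -> (v x : R) - (v a : R) <= (u x : R) - (u a : R).
  rewrite inE; apply: (connect_ind (fun x => (v x : R) - (v a : R) <= (u x : R) - (u a : R))).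
    by rewrite !subrr.
  move=> y z vuy /orP[/andP[yzE /eqP]|/eqP/(track_agree uv)]; last by move: vuy; lra.
  by have := vE _ _ yzE; rewrite /slack; move: vuy; lra.
rewrite /tight /= abE eq_le uE// andbT.
by have := vu _ bS; move: vab; rewrite /slack; lra.
Qed.

Lemma phase u v rho a b n : is_vertex P v -> on_track v rho u -> tight v a b ->
    (#|live_pairs u rho a| <= n)%N ->
  exists k w, [/\ (k <= n)%N, edge_walk P k u w, on_track v rho w & tight w a b].
Proof.
move=> vP uv vab; have abE : (a, b) \in E by case/andP: vab.
have done_phase w : on_track v rho w -> b \in reach w rho a -> tight w a b.
  by move=> wv; apply: reach_tight_target (wv) vab; apply: vertex_poly => //; case: wv.
elim: n u uv => [|n IHn] u uv live_u.
all: have [bS|bS] := boolP (b \in reach u rho a);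
  first by exists 0, u; split=> //; [apply: edge_walk0; case: uv|exact: done_phase].
all: have [w [uw wv lt_live]] := pivot uv abE bS.
  by move: (leq_trans lt_live live_u).
have [k [z [kn wz zv zab]]] := IHn w wv (leq_trans lt_live live_u).
by exists k.+1, z; split=> //; apply: edge_walk_cons uw wz; case: uv.
Qed.

Definition merge rho a b : V -> V := fun x => if rho x == rho b then rho a else rho x.

Lemma card_merge rho a b : rho a != rho b ->
  (#|merge rho a b @: V| < #|rho @: V|)%N.
Proof.
move=> ab; apply: proper_card; apply/properP; split.
  apply/fintype.subsetP => _ /imsetP[x _ ->]; rewrite /merge.
  by case: ifP => _; apply: imset_f.
exists (rho b); first exact: imset_f.
apply/imsetP => -[x _]; rewrite /merge; case: ifPn => [_ /eqP|xb /eqP].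
  by rewrite eq_sym (negPf ab).
by rewrite eq_sym (negPf xb).
Qed.

Lemma on_track_merge u v rho a b : on_track v rho u -> tight u a b -> tight v a b ->
  on_track v (merge rho a b) u.
Proof.
move=> uv uab vab; split; first by case: uv.
  have ab : (u b : R) - (u a : R) = (v b : R) - (v a : R).
    by move: uab vab => /andP[_ /eqP] + /andP[_ /eqP]; rewrite /slack; lra.
  move=> x y; rewrite /merge.
  case: eqP => [xb|_]; case: eqP => [yb|_] xy.
  - by apply: (track_agree uv); rewrite xb yb.
  - by have := track_agree uv xb; have := track_agree uv xy; move: ab; lra.
  - by have := track_agree uv yb; have := track_agree uv xy; move: ab; lra.
  - exact: (track_agree uv).
have sym : connect_sym (intra u (merge rho a b)).
  by apply: sym_connect_sym => x y; rewrite /intra /= eq_sym utight_sym.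
have same x y : rho x = rho y -> connect (intra u (merge rho a b)) x y.
  move=> xy; apply: connect_sub (track_intra uv xy) => s z /andP[/eqP sz usz].
  by apply: connect1; rewrite /intra /= /merge sz eqxx.
have ab : connect (intra u (merge rho a b)) a b.
  by apply: connect1; rewrite /intra /= /utight /= uab /merge eqxx if_same eqxx.
move=> x y; rewrite /merge; case: eqP => [xb|_]; case: eqP => [yb|_] xy.
- by apply: same; rewrite xb yb.
- apply: (connect_trans (same _ _ xb)); rewrite sym in ab.
  by apply: (connect_trans ab); apply: same.
- rewrite sym; apply: (connect_trans (same _ _ yb)); rewrite sym in ab.
  by apply: (connect_trans ab); apply: same.
- exact: same.
Qed.

Lemma live_pairs_arcs u rho a : (#|live_pairs u rho a| <= #|E|)%N.
Proof.
apply: (leq_trans (leq_imset_card _ _)); apply: subset_leq_card.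
by apply/fintype.subsetP => e; rewrite inE => /andP[].
Qed.

Lemma live_pairs_classes u rho a : (#|live_pairs u rho a| <= 'C(#|rho @: V|, 2))%N.
Proof.
rewrite -cards_draws; apply: subset_leq_card; apply/fintype.subsetP => _ /imsetP[[x y] + ->].
rewrite !inE /= cards2 => /and3P[_ -> _]; rewrite andbT.
by apply/fintype.subsetP => z; rewrite !inE => /orP[] /eqP ->; apply: imset_f.
Qed.

Lemma tight_arc_between_classes u v rho : is_vertex P v -> on_track v rho u -> u != v ->
  exists a b, tight v a b /\ rho a != rho b.
Proof.
move=> vP uv u_neq_v.
pose split_arc := [exists a, exists b, tight v a b && (rho a != rho b)].
have [/existsP[a /existsP[b /andP[vab ab]]]|none] := boolP split_arc; first by exists a, b.
have tight_rho x y : tight v x y -> rho x = rho y.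
  move=> xy; apply/eqP; apply: contraR none => xy_rho.
  by apply/existsP; exists x; apply/existsP; exists y; rewrite xy.
have rhoE x y : rho x = rho y.
  apply: (connect_ind (fun y => rho x = rho y) _ _ (vertex_spanning vP x y)) => // s z ->.
  by case/orP => /tight_rho.
case/eqP: u_neq_v; apply/ffunP => x; have := track_agree uv (rhoE r x).
have [_ ->] := (polyP u).1 (vertex_poly (track_vertex uv)).
by have [_ ->] := (polyP v).1 (vertex_poly vP); rewrite !subr0.
Qed.

Lemma walk_to_target u v rho n : is_vertex P v -> on_track v rho u ->
    (#|rho @: V| <= n.+1)%N ->
  exists k, [/\ (k <= n * #|E|)%N, (k <= 'C(n.+2, 3))%N & edge_walk P k u v].
Proof.
move=> vP; elim: n u rho => [|n IHn] u rho uv classes.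
all: have [->|u_neq_v] := eqVneq u v; first by exists 0%N; split=> //; apply: edge_walk0.
all: have [a [b [vab ab]]] := tight_arc_between_classes vP uv u_neq_v.
all: have classes' := leq_trans (card_merge ab) classes.
  have /eqP/cards0_eq/setP/(_ (merge rho a b a)) : #|merge rho a b @: V| == 0%N.
    by rewrite -leqn0.
  by rewrite inE imset_f.
have [k [w [kn uw wv wab]]] := phase vP uv vab (leqnn _).
have [l [lE lC wv']] := IHn w _ (on_track_merge wv wab vab) classes'.
exists (k + l)%N; split; last exact: edge_walk_cat uw wv'.
  by rewrite mulSn leq_add// (leq_trans kn)// live_pairs_arcs.
rewrite binS addnC leq_add// (leq_trans kn)// (leq_trans (live_pairs_classes _ _ _))//.
exact: leq_bin2l.
Qed.

End DualFlow.

Theorem theorem1 (R : realType) (V : finType) (r : V) (E : {set V * V})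
    (c : V -> V -> R) (loopless_E : loopless E)
    (connected_E : weakly_connected E) :
  (comb_diam (dual_flow_polyhedron r E c) <=
   (Num.min ((#|V|%:R - 1) * #|E|%:R) (#|V|%:R ^+ 3 / 6))%:E)%E.
Proof.
have [n Vn] : exists n, #|V| = n.+1.
  by exists #|V|.-1; rewrite prednK//; apply/card_gt0P; exists r.
apply: ge_ereal_sup => _ [u [v [uP vP ->]]].
have uv : on_track r E c v id u.
  by split=> // x y ->; [rewrite !subrr|exact: connect0].
have [k [kE kC uvk]] : exists k, [/\ (k <= n * #|E|)%N, (k <= 'C(n.+2, 3))%N
    & edge_walk (dual_flow_polyhedron r E c) k u v].
  by apply: walk_to_target vP uv _; rewrite -Vn max_card.
apply: (@le_trans _ _ (k%:R)%:E).
  by apply: ereal_inf_lbound; exists k.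
rewrite lee_fin le_min Vn; apply/andP; split.
  by rewrite mulrSr addrK -natrM ler_nat.
rewrite ler_pdivlMr// -natrX -natrM ler_nat.
apply: (@leq_trans ('C(n.+2, 3) * 3`!)%N); first by rewrite leq_mul2r kC orbT.
rewrite bin_ffact !ffactnS ffactn0 /= muln1 !expnS expn0 muln1.
nia.
Qed.
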